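(* Let $b\ge 5$ and $a\ge 2$ be integers such that $a^2$ is a divisor of $b$, and $b$ is not a rational power of $a$. Then $$p_{a,b}(3)-p_{a,b}(2)\ne p_{a,b}(2)-p_{a,b}(1).$$ In particular, under these assumptions on $a$ and $b$, the complexity function $p_{a,b}(n)$ is not affine for $n\ge 1$ (i.e., it is not of the form $p_{a,b}(n)=cn+d$ for all integers $n\ge1$).
   Context: For an integer $b\ge 3$ and a real $x>0$, the leading digit $D_b(x)\in\{1,2,\dots,b-1\}$ of $x$ in base $b$ is defined by: $D_b(x)=d$ if and only if $d\cdot b^j\le x<(d+1)b^j$ for some $j\in\mathbb{Z}$. For real $a>0$, the leading digit sequence is $S_{a,b}=\{D_b(a^n)\}_{n=1}^\infty$. Its (block) complexity function is $$p_{a,b}(n)=\#\{(D_b(a^m),D_b(a^{m+1}),\dots,D_b(a^{m+n-1})): m=1,2,\dots\},$$ the number of distinct blocks of $n$ consecutive terms occurring in $S_{a,b}$. *)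

(* Defs.v *)
From mathcomp Require Import all_boot all_order all_algebra finmap.
From mathcomp Require Import all_classical all_reals sequences exp.
Set Implicit Arguments.
Unset Strict Implicit.
Unset Printing Implicit Defensive.
Import Order.TTheory GRing.Theory Num.Theory.
Local Open Scope classical_set_scope.
Local Open Scope ring_scope.

Definition is_leading_digit (R : realType) (b : nat) (x : R) (d : nat) : Prop :=
  (1 <= d < b)%N /\
  exists j : int, d%:R * b%:R ^ j <= x < d.+1%:R * b%:R ^ j.

(* The default value 0 is only taken when no leading digit exists; for b >= 2
   and x > 0 this does not happen, see [leading_digitP] below. *)
Definition leading_digit (R : realType) (b : nat) (x : R) : nat :=
  xget 0%N [set d | is_leading_digit b x d].

(* [leading_digit_seq a b m] is the term of index m; the sequence starts at
   m = 1, and the term of index 0 is never used. *)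
Definition leading_digit_seq (R : realType) (a : R) (b m : nat) : nat :=
  leading_digit b (a ^+ m).

Definition digit_block (R : realType) (a : R) (b n m : nat) : n.-tuple nat :=
  [tuple leading_digit_seq a b (m + i)%N | i < n].

Definition digit_blocks (R : realType) (a : R) (b n : nat) :
    set (n.-tuple nat) :=
  [set digit_block a b n m | m in [set m | (1 <= m)%N]].
Arguments digit_blocks {R} a b n _.

(* [fset_set] is empty on infinite sets; see [finite_digit_blocks] below. *)
Definition block_complexity (R : realType) (a : R) (b n : nat) : nat :=
  #|` fset_set (digit_blocks a b n)|%fset.

Lemma is_leading_digit_unique (R : realType) (b : nat) (x : R) (d e : nat) :
  (1 < b)%N -> is_leading_digit b x d -> is_leading_digit b x e -> d = e.
Proof.
move=> b1.
have b1R : 1 < b%:R :> R by rewrite ltr1n.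
have b0R : 0 < b%:R :> R by rewrite (lt_trans _ b1R).
have step (d' e' : nat) (j k : int) : (0 < d')%N -> (e' < b)%N ->
    d'%:R * b%:R ^ j <= x -> x < e'.+1%:R * b%:R ^ k -> j <= k.
  move=> d0 eb dx xe; rewrite leNgt; apply/negP => kj.
  have : b%:R ^ (k + 1) <= x.
    apply: le_trans dx; apply: (@le_trans _ _ (b%:R ^ j)).
      by rewrite ler_eXz2l // lezD1.
    by rewrite ler_peMl ?exprz_ge0 ?ler1n // ltW.
  rewrite leNgt => /negP; apply; apply: lt_le_trans xe _.
  rewrite expfzDr ?gt_eqF // expr1z mulrC.
  by rewrite ler_wpM2l ?exprz_ge0 ?ler_nat.
move=> [/andP[d1 db] [j /andP[dx xd]]] [/andP[e1 eb] [k /andP[ex xe]]].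
have jk : j = k.
  by apply/eqP; rewrite eq_le (step d e) // (step e d).
subst k; have bj : 0 < b%:R ^ j :> R by rewrite exprz_gt0.
apply/eqP; rewrite eqn_leq -ltnS -(ltr_nat R) -(ltr_pM2r bj) (le_lt_trans dx xe).
by rewrite -ltnS -(ltr_nat R) -(ltr_pM2r bj) (le_lt_trans ex xd).
Qed.

Lemma is_leading_digit_exists (R : realType) (b : nat) (x : R) :
  (1 < b)%N -> 0 < x -> exists d, is_leading_digit b x d.
Proof.
move=> b1 x0.
have b1R : 1 < b%:R :> R by rewrite ltr1n.
have b0R : 0 < b%:R :> R by rewrite (lt_trans _ b1R).
have lnb : 0 < ln (b%:R : R) by rewrite ln_gt0.
pose j := Num.floor (ln x / ln (b%:R : R)).
have bE (k : int) : b%:R ^ k = expR (k%:~R * ln (b%:R : R)).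
  by rewrite -powR_intmul ?ltW // /powR gt_eqF.
have bj : 0 < b%:R ^ j :> R by rewrite exprz_gt0.
have lej : b%:R ^ j <= x.
  rewrite bE -[leRHS]lnK ?posrE // ler_expR -ler_pdivlMr //.
  exact: Num.Theory.floor_le.
have ltj : x < b%:R ^ (j + 1).
  rewrite bE -[ltLHS]lnK ?posrE // ltr_expR -ltr_pdivrMr //.
  exact: floorD1_gt.
have q0 : 0 <= x / b%:R ^ j by rewrite divr_ge0 // ltW.
have /andP[tl tu] := truncn_itv q0.
exists (Num.truncn (x / b%:R ^ j)); split; last first.
  by exists j; rewrite -ler_pdivlMr // tl -ltr_pdivrMr.
apply/andP; split.
  by rewrite -ltnS -(ltr_nat R) (le_lt_trans _ tu) // ler_pdivlMr // mul1r.
rewrite -(ltr_nat R) (le_lt_trans tl) // ltr_pdivrMr //.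
by rewrite -[X in X * _]expr1z -expfzDr ?gt_eqF // addrC.
Qed.

Lemma leading_digitP (R : realType) (b : nat) (x : R) (d : nat) :
  (1 < b)%N -> 0 < x -> leading_digit b x = d <-> is_leading_digit b x d.
Proof.
move=> b1 x0; have xD : is_leading_digit b x (leading_digit b x).
  exact: (xgetPex 0%N (is_leading_digit_exists b1 x0)).
by split=> [<-//|]; exact: is_leading_digit_unique.
Qed.

Lemma leading_digit_le (R : realType) (b : nat) (x : R) :
  (leading_digit b x <= b)%N.
Proof. by rewrite /leading_digit; case: xgetP => // d _ [/andP[_ /ltnW]]. Qed.

Lemma finite_digit_blocks (R : realType) (a : R) (b n : nat) :
  finite_set (digit_blocks a b n).
Proof.
pose f (t : n.-tuple 'I_b.+1) : n.-tuple nat := [tuple of map val t].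
apply: (@sub_finite_set _ _ (f @` [set: n.-tuple 'I_b.+1])); last first.
  exact/finite_image/finite_finset.
move=> _ [m _ <-].
exists [tuple inord (leading_digit_seq a b (m + i)) | i < n] => //.
apply: eq_from_tnth => i; rewrite !tnth_map tnth_ord_tuple /= inordK //.
by rewrite ltnS leading_digit_le.
Qed.

(* Main.v *)
Require Import Defs.
From mathcomp Require Import all_boot all_order all_algebra finmap.
From mathcomp Require Import all_classical all_reals sequences exp.
From mathcomp Require Import ring lra.
Set Implicit Arguments.
Unset Strict Implicit.
Import Order.TTheory GRing.Theory Num.Theory.
Local Open Scope ring_scope.

(** Multiplication by a acts on mantissas x in [1, b) as a rotation of the
    circle R_{>0} / <b>, and the leading digit cuts this circle at the points
    1, ..., b - 1. A block of L + 1 digits records the cell of x for the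
    partition whose cuts are all d / a^i (modulo powers of b) with
    1 <= d < b and 0 <= i <= L, so the complexity is a count of cuts.

    If a^L <= b, the whole block can be read off one integer: the integer part
    N of a^L x, which lies in [a^L, a^L b). Digit number i is the quotient of N
    by a^(L-i), divided once more by b when that quotient reaches b
    ([digit_block_of_prefix]). Since log a / log b is irrational, its multiples
    are dense modulo 1, so every such N occurs as a string of initial digits of
    some power of a ([prefix_occurs]). Hence the complexity at L + 1 is the
    number of distinct blocks over all N in [a^L, a^L b)
    ([digit_blocksE]).

    If moreover a^L divides b, this number is computed exactly. For N < b the
    last digit is N itself, so all b - a^L of these N give different blocks.
    For a^(s-1) b <= N < a^s b with 1 <= s <= L, divisibility makes every digit
    a function of the quotient e of N by a^s, which is itself one of the digits
    and ranges over [b / a, b). Therefore ([block_complexity_expn])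

      p(L + 1) = b - a^L + L (b - b / a).

    The hypothesis a^2 | b gives this for L = 0, 1, 2; the linear part cancels
    in the second difference, which equals - a^2 + 2 a - 1 = - (a - 1)^2, and
    this is nonzero. *)

(** * Density of the multiples of an irrational number modulo 1 *)

(** Pigeonhole: among the fractional parts of 0, t, ..., (K+1) t, two share one
    of the K + 1 subintervals of [0, 1) of length 1 / (K+1). *)
Lemma exists_small_multiple (R : realType) (t : R) (K : nat) :
  exists n : nat, exists2 j : int,
    (0 < n)%N & `|n%:R * t - j%:~R| < K.+1%:R^-1.
Proof.
pose fr i : R := i%:R * t - (Num.floor (i%:R * t))%:~R.
have fr0 i : 0 <= fr i by rewrite subr_ge0 Num.Theory.floor_le.
have fr1 i : fr i < 1.
  by rewrite ltrBlDl -[X in _ + X]/(1%:~R) -intrD floorD1_gt.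
have K0 : 0 < K.+1%:R :> R by rewrite ltr0n.
pose bin i := Num.truncn (K.+1%:R * fr i).
have binP i : (bin i)%:R <= K.+1%:R * fr i < (bin i).+1%:R.
  by apply: truncn_itv; rewrite mulr_ge0 // ltW.
have binK i : (bin i < K.+1)%N.
  have /andP[le_bin _] := binP i.
  by rewrite -(ltr_nat R) (le_lt_trans le_bin) // gtr_pMr.
pose f (i : 'I_K.+2) : 'I_K.+1 := Ordinal (binK i).
have : ~~ injectiveb f.
  by apply/injectiveP => /leq_card; rewrite !card_ord ltnn.
move=> /injectivePn[i [k ik /(congr1 val) /= eq_bin]].
wlog lt_ik : i k ik eq_bin / (i < k)%N.
  move=> H; have [lt|lt|/val_inj eq_ik] := ltngtP i k.
  - exact: (H i k).
  - by apply: (H k i); rewrite // eq_sym.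
  - by rewrite eq_ik eqxx in ik.
exists (k - i)%N, (Num.floor (k%:R * t) - Num.floor (i%:R * t)).
  by rewrite subn_gt0.
rewrite natrB ?(ltnW lt_ik) // intrB.
have -> : (k%:R - i%:R) * t
    - ((Num.floor (k%:R * t))%:~R - (Num.floor (i%:R * t))%:~R) = fr k - fr i.
  by rewrite /fr; ring.
rewrite -[ltRHS]mulr1 ltr_pdivlMl // -[X in X * _]gtr0_norm // -normrM mulrBr.
have /andP[] := binP i; have /andP[] := binP k.
rewrite eq_bin -natr1 ltr_norml => *; apply/andP; split; lra.
Qed.

(** Repeating a positive step shorter than v - u cannot jump over the interval.
    The target is first translated by a large integer P, so that more than M
    steps are needed to reach it. *)
Lemma multiples_dense_of_small_step (R : realType) (t u v : R) (n M : nat)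
    (j : int) :
  (0 < n)%N -> 0 < n%:R * t - j%:~R -> n%:R * t - j%:~R < v - u ->
  exists m : nat, exists2 p : int, (M <= m)%N & u < m%:R * t - p%:~R < v.
Proof.
set d : R := _ - _ => n0 d0 duv.
pose P := (Num.truncn (M%:R * d - u)).+1.
have leP : M%:R * d - u < P%:R by exact: truncnS_gt.
pose x := (u + P%:R) / d.
have Mx : M%:R < x by rewrite ltr_pdivlMr //; lra.
have /andP[kx xk] : (Num.truncn x)%:R <= x < (Num.truncn x).+1%:R.
  by apply: truncn_itv; rewrite (le_trans _ (ltW Mx)).
move: kx xk; rewrite ler_pdivlMr // ltr_pdivrMr //.
set k := Num.truncn x => kx xk.
have Mk : (M <= k.+1)%N.
  by rewrite -(ler_nat R) ltW // (lt_trans Mx) // truncnS_gt.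
exists (k.+1 * n)%N, (k.+1%:Z * j + P%:Z).
  by rewrite (leq_trans Mk) // leq_pmulr.
rewrite intrD intrM natrM -!pmulrn.
have -> : k.+1%:R * n%:R * t - (k.+1%:R * j%:~R + P%:R) = k.+1%:R * d - P%:R.
  by rewrite /d; ring.
move: xk; rewrite -natr1 => xk; apply/andP; split; lra.
Qed.

(** Kronecker's theorem in dimension one. The lower bound M on the multiplier
    leaves room to shift the index afterwards. *)
Lemma multiples_dense_mod_one (R : realType) (t u v : R) (M : nat) :
  (forall (n : nat) (j : int), (0 < n)%N -> n%:R * t <> j%:~R) -> u < v ->
  exists m : nat, exists2 p : int, (M <= m)%N & u < m%:R * t - p%:~R < v.
Proof.
move=> irr uv.
have [n [j n0 small]] :=
  exists_small_multiple t (Num.truncn (v - u)^-1).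
have {}small : `|n%:R * t - j%:~R| < v - u.
  apply: lt_trans small _; rewrite invf_plt ?posrE ?subr_gt0 //.
  exact: truncnS_gt.
have [neg|pos|eq0] := ltrgtP (n%:R * t - j%:~R) 0.
(* A negative step is a positive step for the reflected problem. *)
- have [||m [p Mm pP]] :=
    @multiples_dense_of_small_step R (- t) (- v) (- u) n M (- j) n0.
  + by rewrite rmorphN /=; lra.
  + by move: small; rewrite ltr0_norm // rmorphN /=; lra.
  + exists m, (- p) => //; move: pP; rewrite rmorphN /= => /andP[? ?].
    by apply/andP; split; lra.
- apply: (@multiples_dense_of_small_step R t u v n M j) => //.
  by rewrite gtr0_norm in small.
- by case: (irr n j n0); apply/eqP; rewrite -subr_eq0 eq0.
Qed.

(** * Blocks of leading digits as functions of an integer prefix *)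

(** In logarithms to base b the two inequalities ask a multiple of
    log a / log b to fall, modulo 1, between log N and log (N + 1). *)
Lemma prefix_occurs (R : realType) (a b N M : nat) :
  (1 < a)%N -> (1 < b)%N -> (0 < N)%N ->
  (forall q : rat, (b%:R : R) <> a%:R `^ ratr q) ->
  exists m : nat, exists2 j : int, (M <= m)%N &
    N%:R * b%:R ^ j <= (a%:R : R) ^+ m < N.+1%:R * b%:R ^ j.
Proof.
move=> a1 b1 N0 irr.
have a0 : 0 < a%:R :> R by rewrite ltr0n ltnW.
have b0 : 0 < b%:R :> R by rewrite ltr0n ltnW.
have lna : 0 < ln (a%:R : R) by rewrite ln_gt0 // ltr1n.
have lnb : 0 < ln (b%:R : R) by rewrite ln_gt0 // ltr1n.
have [||m [j Mm]] := @multiples_dense_mod_one R (ln a%:R / ln b%:R)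
    (ln N%:R / ln b%:R) (ln N.+1%:R / ln b%:R) M.
- move=> n j n0 /(congr1 ( *%R^~ (ln b%:R))).
  rewrite mulrA divfK ?gt_eqF // => eq_ln.
  have j0 : j != 0.
    apply: contra_eq_neq eq_ln => ->; rewrite mul0r.
    by rewrite mulf_neq0 ?gt_eqF ?ltr0n.
  apply: (irr (n%:R / j%:~R)).
  rewrite fmorph_div /= ratr_nat ratr_int /powR gt_eqF // mulrAC eq_ln.
  by rewrite mulrAC divff ?intr_eq0 // mul1r lnK.
- by rewrite ltr_pM2r ?invr_gt0 // ltr_ln ?posrE ?ltr0n // ltr_nat.
rewrite ltrBrDr ltrBlDr -[X in X && _](ltr_pM2r lnb).
rewrite -[X in _ && X](ltr_pM2r lnb).
rewrite !mulrDl !mulrA !divfK ?gt_eqF //.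
have bj : 0 < b%:R ^ j :> R by rewrite exprz_gt0.
have lnbj : ln (b%:R ^ j) = j%:~R * ln b%:R :> R.
  by rewrite -powR_intmul ?ltW // ln_powR.
have NR : 0 < N%:R :> R by rewrite ltr0n.
rewrite -lnbj mulr_natl -lnXn // -!lnM ?posrE ?ltr0Sn //.
rewrite !ltr_ln ?posrE ?exprn_gt0 ?mulr_gt0 ?ltr0Sn // => /andP[/ltW lo hi].
by exists m, j; rewrite // lo.
Qed.

(** Integer division of the prefix N by k undoes a multiplication of y by k,
    because the bounds on the digit are integers; division by b ^ i only moves
    the power of b. *)
Lemma leading_digit_of_prefix (R : realType) (b N k i : nat) (j : int) (y : R) :
  (1 < b)%N -> (0 < k)%N -> 0 < y -> (0 < N %/ (k * b ^ i) < b)%N ->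
  N%:R * b%:R ^ j <= k%:R * y < N.+1%:R * b%:R ^ j ->
  leading_digit b y = (N %/ (k * b ^ i))%N.
Proof.
move=> b1 k0 y0 qb /andP[lo hi]; apply/leading_digitP => //; split=> //.
have b0 : 0 < b%:R :> R by rewrite ltr0n ltnW.
have bj : 0 < b%:R ^ j :> R by rewrite exprz_gt0.
have kR : 0 < k%:R :> R by rewrite ltr0n.
exists (i%:Z + j); rewrite expfzDr ?gt_eqF // -exprnP.
rewrite -(ler_pM2l kR) -[X in _ && X](ltr_pM2l kR).
have scale (q : nat) : k%:R * (q%:R * (b%:R ^+ i * b%:R ^ j))
    = (q * (k * b ^ i))%:R * b%:R ^ j :> R.
  by rewrite !natrM natrX; ring.
rewrite !scale; apply/andP; split.
  by apply: le_trans lo; rewrite ler_pM2r // ler_nat leq_divM.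
apply: (lt_le_trans hi); rewrite ler_pM2r // ler_nat ltn_ceil //.
by rewrite muln_gt0 k0 expn_gt0 ltnW.
Qed.

(** The leading digit of x / k, when N is the integer part of some x in
    [k, k b^2): a quotient that reaches b is brought back to a single digit by
    one division by b. *)
Definition prefix_digit (b k N : nat) : nat :=
  if (N < k * b)%N then (N %/ k)%N else (N %/ (k * b))%N.

Definition prefix_block (a b L N : nat) : L.+1.-tuple nat :=
  [tuple prefix_digit b (a ^ (L - i)) N | i < L.+1].

Lemma prefix_blockP (a b L N N' : nat) :
  prefix_block a b L N = prefix_block a b L N' <->
  (forall l, (l <= L)%N -> prefix_digit b (a ^ l) N = prefix_digit b (a ^ l) N').
Proof.
split=> [eqNN' l lL | eqNN'].
  have := congr1 (fun t => tnth t (inord (L - l))) eqNN'.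
  by rewrite !tnth_mktuple inordK ?ltnS ?leq_subr // subKn.
by apply: eq_from_tnth => i; rewrite !tnth_mktuple eqNN' // leq_subr.
Qed.

Lemma digit_block_of_prefix (R : realType) (a b L N m : nat) (j : int) :
  (1 < a)%N -> (1 < b)%N -> (a ^ L <= b)%N -> (a ^ L <= N < a ^ L * b)%N ->
  N%:R * b%:R ^ j <= (a%:R : R) ^+ (m + L) < N.+1%:R * b%:R ^ j ->
  digit_block (a%:R : R) b L.+1 m = prefix_block a b L N.
Proof.
move=> a1 b1 aLb /andP[loN hiN] Nm; apply: eq_from_tnth => i.
rewrite !tnth_mktuple /leading_digit_seq /prefix_digit.
have iL : (i <= L)%N by rewrite -ltnS.
set k := (a ^ (L - i))%N.
have k0 : (0 < k)%N by rewrite expn_gt0 ltnW.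
have kL : (k <= a ^ L)%N by rewrite leq_exp2l // leq_subr.
have y0 : 0 < (a%:R : R) ^+ (m + i) by rewrite exprn_gt0 // ltr0n ltnW.
have {}Nm : N%:R * b%:R ^ j <= k%:R * (a%:R : R) ^+ (m + i)
    < N.+1%:R * b%:R ^ j.
  by rewrite natrX -exprD addnCA subnK.
case: ltnP => Nk.
  rewrite -[X in (_ %/ X)%N]muln1 -(expn0 b).
  apply: leading_digit_of_prefix Nm => //.
  by rewrite expn0 muln1 divn_gt0 // (leq_trans kL) //= ltn_divLR // mulnC.
rewrite -[X in (k * X)%N]expn1; apply: leading_digit_of_prefix Nm => //.
have b0 : (0 < b)%N by rewrite ltnW.
rewrite expn1 divn_gt0 ?muln_gt0 ?k0 // Nk /= ltn_divLR ?muln_gt0 ?k0 //.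
apply: (leq_trans hiN); rewrite mulnA leq_pmul2r // (leq_trans aLb) //.
by rewrite leq_pmulr.
Qed.

(** Every power of a has a prefix N in the given range, since its mantissa lies
    in [1, b), and conversely every N in the range is a prefix by density. *)
Lemma digit_blocksE (R : realType) (a b L : nat) :
  (1 < a)%N -> (1 < b)%N -> (a ^ L <= b)%N ->
  (forall q : rat, (b%:R : R) <> a%:R `^ ratr q) ->
  digit_blocks (a%:R : R) b L.+1 =
  [set prefix_block a b L N | N in [set N | (a ^ L <= N < a ^ L * b)%N]]%classic.
Proof.
move=> a1 b1 aLb irr.
have a0 : 0 < a%:R :> R by rewrite ltr0n ltnW.
have b0 : 0 < b%:R :> R by rewrite ltr0n ltnW.
apply/seteqP; split=> [t [m m1 <-] | t [N /= NaL <-]].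
  have [d [/andP[d0 db] [j /andP[dm md]]]] :=
    is_leading_digit_exists b1 (exprn_gt0 m a0).
  have bj : 0 < b%:R ^ j :> R by rewrite exprz_gt0.
  pose x : R := a%:R ^+ (m + L) / b%:R ^ j.
  have /truncn_itv xP : 0 <= x by rewrite divr_ge0 // ?exprn_ge0 // ltW.
  set N := Num.truncn x in xP.
  have xE : x = a%:R ^+ L * (a%:R ^+ m / b%:R ^ j) by rewrite /x exprD; ring.
  have aL0 : 0 < a%:R ^+ L :> R by rewrite exprn_gt0.
  have Nb : (a ^ L <= N < a ^ L * b)%N.
    case/andP: xP => Nx xN; rewrite -[(_ <= N)%N]ltnS -2!(ltr_nat R).
    rewrite natrM !natrX; apply/andP; split.
      apply: le_lt_trans xN; rewrite xE ler_peMr ?(ltW aL0) //.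
      rewrite ler_pdivlMr // mul1r; apply: le_trans dm.
      by rewrite ler_peMl ?ler1n // ltW.
    apply: le_lt_trans Nx _; rewrite xE ltr_pM2l // ltr_pdivrMr //.
    by apply: (lt_le_trans md); rewrite ler_pM2r // ler_nat.
  exists N => //; apply/esym/(digit_block_of_prefix (j := j)) => //.
  by rewrite -ler_pdivlMr // -ltr_pdivrMr.
have N0 : (0 < N)%N.
  by case/andP: NaL => /(leq_trans _) -> //; rewrite expn_gt0 ltnW.
have [m [j Lm Nm]] := prefix_occurs L.+1 a1 b1 N0 irr.
(* N is a prefix of the last power of the block, hence the shift. *)
exists (m - L)%N; first by rewrite /= subn_gt0.
by apply: (digit_block_of_prefix (j := j)) => //; rewrite subnK // ltnW.
Qed.

(** * Counting the blocks *)

(** When a^L divides b, these are the least elements of the classes of prefixes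
    in [a^L, a^L b) with the same block: the classes are singletons below b,
    and of the form [a^s e, a^s (e + 1)) within [a^(s-1) b, a^s b). *)
Definition block_starts (a b L : nat) : seq nat :=
  iota (a ^ L) (b - a ^ L) ++
  [seq (a ^ s * e)%N | s <- iota 1 L, e <- iota (b %/ a) (b - b %/ a)].

Lemma mem_block_starts (a b L N : nat) : (a ^ L <= b)%N ->
  reflect ((a ^ L <= N < b)%N \/
           exists s e,
             [/\ (0 < s <= L)%N, (b %/ a <= e < b)%N & N = (a ^ s * e)%N])
          (N \in block_starts a b L).
Proof.
move=> aLb; have ba : (b %/ a <= b)%N by exact: leq_div.
rewrite mem_cat mem_iota subnKC //.
apply: (iffP orP) => -[|]; try by left.
  move=> /allpairsP[[s e]] /=; rewrite !mem_iota subnKC // add1n ltnS => -[*].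
  by right; exists s, e.
move=> [s [e [sL eb ->]]]; right; apply/allpairsP; exists (s, e).
by rewrite /= !mem_iota subnKC // add1n ltnS.
Qed.

Lemma dvdn_of_expn (a b s L : nat) :
  (0 < s <= L)%N -> (a ^ L %| b)%N -> (a %| b)%N.
Proof.
by move=> /andP[s0 sL]; apply: dvdn_trans; rewrite dvdn_exp // (leq_trans s0).
Qed.

Lemma expnS_mul_divn (a b s : nat) :
  (a %| b)%N -> (a ^ s.+1 * (b %/ a) = a ^ s * b)%N.
Proof. by move=> ab; rewrite expnSr -mulnA [(a * _)%N]mulnC divnK. Qed.

(** The representatives given by s > 0 do not overlap those below b. *)
Lemma block_starts_ge (a b s e : nat) :
  (0 < a)%N -> (0 < s)%N -> (a %| b)%N -> (b %/ a <= e)%N ->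
  (b <= a ^ s * e)%N.
Proof.
case: s => // s a0 _ ab be; apply: (@leq_trans (a ^ s.+1 * (b %/ a))).
  by rewrite expnS_mul_divn // leq_pmull // expn_gt0 a0.
by rewrite leq_mul2l be orbT.
Qed.

Lemma block_starts_range (a b L N : nat) :
  (1 < a)%N -> (0 < b)%N -> (a ^ L %| b)%N -> N \in block_starts a b L ->
  (a ^ L <= N < a ^ L * b)%N.
Proof.
move=> a1 b0 aLb; have a0 : (0 < a)%N by rewrite ltnW.
have aLb' : (a ^ L <= b)%N by exact: dvdn_leq.
move=> /(mem_block_starts _ aLb')[/andP[-> Nb]|].
  by rewrite (leq_trans Nb) // leq_pmull // expn_gt0 a0.
move=> [s [e [/andP[s0 sL] /andP[be eb] ->]]].
have ab : (a %| b)%N by apply: (@dvdn_of_expn a b s L); rewrite ?s0.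
rewrite (leq_trans aLb' (block_starts_ge a0 s0 ab be)) /=.
apply: (@leq_trans (a ^ s * b)); first by rewrite ltn_pmul2l ?expn_gt0 ?a0.
by rewrite leq_pmul2r // leq_exp2l.
Qed.

(** Rounding N down to a multiple of a^s, for the s with
    a^(s-1) b <= N < a^s b, changes no digit: each digit is a quotient of N by
    a^l with l >= s or by a^l b with l < s, and all of these divisors are
    multiples of a^s because a^L divides b. *)
Lemma same_block_as_start (a b L N : nat) :
  (1 < a)%N -> (0 < b)%N -> (a ^ L %| b)%N -> (a ^ L <= N < a ^ L * b)%N ->
  exists2 N', N' \in block_starts a b L &
    prefix_block a b L N = prefix_block a b L N'.
Proof.
move=> a1 b0 aLb /andP[loN hiN]; have a0 : (0 < a)%N by rewrite ltnW.
have aLb' : (a ^ L <= b)%N by exact: dvdn_leq.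
have [Nb|bN] := ltnP N b.
  by exists N => //; apply/mem_block_starts => //; left; rewrite loN.
have exs : exists s, (N < a ^ s * b)%N by exists L.
case: (ex_minnP exs) => -[|s] Ns mins.
  by rewrite expn0 mul1n ltnNge bN in Ns.
have sL : (s < L)%N by exact: mins.
have sN : (a ^ s * b <= N)%N.
  by rewrite leqNgt; apply/negP => /mins; rewrite ltnn.
have adivb : (a %| b)%N by apply: (@dvdn_of_expn a b s.+1 L).
have as0 : (0 < a ^ s.+1)%N by rewrite expn_gt0 a0.
pose e := (N %/ a ^ s.+1)%N.
have eN : (a ^ s.+1 * e <= N)%N by rewrite mulnC leq_divM.
have ab : (a ^ s.+1 * (b %/ a) = a ^ s * b)%N.
  exact: expnS_mul_divn.
have le_e : (b %/ a <= e)%N by rewrite leq_divRL // mulnC ab.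
have lt_e : (e < b)%N by rewrite ltn_divLR // mulnC.
exists (a ^ s.+1 * e)%N.
  by apply/mem_block_starts => //; right; exists s.+1, e; rewrite le_e lt_e sL.
have same q : ((a ^ s.+1 * e) %/ (a ^ s.+1 * q) = N %/ (a ^ s.+1 * q))%N.
  by rewrite divnMl // divnMA.
apply/prefix_blockP => l lL; rewrite /prefix_digit.
have [sl|ls] := leqP s.+1 l.
  have slb : (a ^ s.+1 * b <= a ^ l * b)%N by rewrite leq_pmul2r // leq_exp2l.
  rewrite (leq_trans Ns slb) (leq_trans _ slb); last by rewrite ltn_pmul2l.
  by rewrite -(subnKC sl) expnD same.
have lsb : (a ^ l * b <= a ^ s * b)%N by rewrite leq_pmul2r // leq_exp2l.
rewrite !ltnNge (leq_trans lsb sN) (leq_trans lsb) /=; last first.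
  by rewrite -ab leq_pmul2l.
have /dvdnP[q ->] : (a ^ s.+1 %| a ^ l * b)%N.
  by apply/dvdn_mull/(dvdn_trans _ aLb); rewrite dvdn_exp2l.
by rewrite mulnC same.
Qed.

(** Representatives with different s lie in the disjoint ranges
    [a^(s-1) b, a^s b). *)
Lemma block_starts_lt (a b s s' e e' : nat) :
  (1 < a)%N -> (a %| b)%N -> (s' < s)%N -> (e' < b)%N -> (b %/ a <= e)%N ->
  (a ^ s' * e' < a ^ s * (b %/ a) <= a ^ s * e)%N.
Proof.
move=> a1 ab; case: s => // s s's e'b be; have a0 : (0 < a)%N by rewrite ltnW.
rewrite leq_pmul2l ?expn_gt0 ?a0 // be andbT.
rewrite expnS_mul_divn //.
apply: (@leq_trans (a ^ s' * b)); first by rewrite ltn_pmul2l ?expn_gt0 ?a0.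
by rewrite leq_mul2r leq_exp2l // -ltnS s's orbT.
Qed.

Lemma block_starts_uniq (a b L : nat) :
  (1 < a)%N -> (0 < b)%N -> (a ^ L %| b)%N -> uniq (block_starts a b L).
Proof.
move=> a1 b0 aLb; have a0 : (0 < a)%N by rewrite ltnW.
have aLb' : (a ^ L <= b)%N by exact: dvdn_leq.
have ba : (b %/ a <= b)%N by exact: leq_div.
have startP s e :
    (s, e) \in [seq (s, e) | s <- iota 1 L, e <- iota (b %/ a) (b - b %/ a)] ->
    [/\ (a %| b)%N, (0 < s)%N & (b %/ a <= e < b)%N].
  move=> /allpairsP[[x y] /= [+ + [-> ->]]].
  rewrite !mem_iota subnKC // add1n ltnS => /andP[s0 sL] eb; split=> //.
  by apply: (@dvdn_of_expn a b x L); rewrite ?s0.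
rewrite cat_uniq iota_uniq /=; apply/andP; split.
  apply/hasPn => _ /allpairsP[[s e] /= [sP eP ->]].
  have [|ab s0 /andP[be _]] := startP s e.
    by apply/allpairsP; exists (s, e).
  rewrite mem_iota subnKC // negb_and -leqNgt; apply/orP; right.
  exact: block_starts_ge.
apply: allpairs_uniq; rewrite ?iota_uniq // => -[s e] [s' e'].
move=> /startP[ab s0 /andP[be eb]] /startP[_ s'0 /andP[be' e'b]] /= eq_se.
have [ss'|s's|eq_s] := ltngtP s s'.
- have /andP[lt1 /(leq_trans lt1)] := block_starts_lt a1 ab ss' eb be'.
  by rewrite eq_se ltnn.
- have /andP[lt1 /(leq_trans lt1)] := block_starts_lt a1 ab s's e'b be.
  by rewrite eq_se ltnn.
- move/eqP: eq_se; rewrite eq_s eqn_pmul2l ?expn_gt0 ?a0 //.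
  by move=> /eqP ->.
Qed.

(** A representative is recovered from its block. Below b it is the last digit.
    From b on the last digit is less than a^L, which separates the two cases.
    The digit that is the quotient by a^s is e for the representative a^s e,
    and is less than b / a for one with a smaller s. *)
Lemma prefix_block_inj (a b L : nat) :
  (1 < a)%N -> (0 < b)%N -> (a ^ L %| b)%N ->
  {in block_starts a b L &, injective (prefix_block a b L)}.
Proof.
move=> a1 b0 aLb; have a0 : (0 < a)%N by rewrite ltnW.
have aLb' : (a ^ L <= b)%N by exact: dvdn_leq.
have digit0 N : prefix_digit b (a ^ 0) N = if (N < b)%N then N else (N %/ b)%N.
  by rewrite /prefix_digit expn0 mul1n divn1.
have long (N s e : nat) : (a ^ L <= N < b)%N -> (s <= L)%N -> (e < b)%N ->
    (b <= a ^ s * e)%N -> prefix_block a b L N <> prefix_block a b L (a ^ s * e).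
  move=> /andP[aN Nb] sL eb b_se /prefix_blockP/(_ 0%N isT).
  rewrite !digit0 Nb ltnNge b_se /= => eqN.
  have : (N < a ^ L)%N.
    rewrite eqN ltn_divLR //; apply: (@leq_trans (a ^ s * b)).
      by rewrite ltn_pmul2l ?expn_gt0 ?a0.
    by rewrite leq_pmul2r // leq_exp2l.
  by rewrite ltnNge aN.
have start s e : (0 < s <= L)%N -> (b %/ a <= e < b)%N ->
    [/\ (a %| b)%N, (s <= L)%N, (e < b)%N & (b <= a ^ s * e)%N].
  move=> /andP[s0 sL] /andP[be eb].
  have ab : (a %| b)%N by apply: (@dvdn_of_expn a b s L); rewrite ?s0.
  by split=> //; apply: block_starts_ge.
move=> N N' /(mem_block_starts _ aLb')[NL|[s [e [sP eP ->]]]]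
  /(mem_block_starts _ aLb')[NL'|[s' [e' [sP' eP' ->]]]].
- move/prefix_blockP/(_ 0%N isT); rewrite !digit0.
  by have [/andP[_ ->] /andP[_ ->]] := (NL, NL').
- by have [_ ? ? ? /long] := start _ _ sP' eP'; case.
- by have [_ ? ? ? /esym/long] := start _ _ sP eP; case.
wlog le_s : s s' e e' sP sP' eP eP' / (s' <= s)%N.
  move=> H eqB; have [le|lt] := leqP s' s; first exact: H.
  by apply/esym/H => //; apply: ltnW.
have [ab sL eb _] := start _ _ sP eP; have [_ _ eb' _] := start _ _ sP' eP'.
have as0 : (0 < a ^ s)%N by rewrite expn_gt0 a0.
move=> /prefix_blockP/(_ s sL); rewrite /prefix_digit ltn_pmul2l // eb mulKn //.
have [->|s's] := eqVneq s' s; first by rewrite ltn_pmul2l // eb' mulKn // => ->.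
have {}s's : (s' < s)%N by rewrite ltn_neqAle s's.
have /andP[be _] := eP; have /andP[lt1 _] := block_starts_lt a1 ab s's eb' be.
have -> : (a ^ s' * e' < a ^ s * b)%N.
  by apply: leq_trans lt1 _; rewrite leq_pmul2l // leq_div.
move=> eq_e.
by move: be; rewrite leqNgt eq_e ltn_divLR // [(b %/ a * _)%N]mulnC lt1.
Qed.

(** * The complexity function *)

Lemma block_complexity_expn (R : realType) (a b L : nat) :
  (1 < a)%N -> (1 < b)%N -> (a ^ L %| b)%N ->
  (forall q : rat, (b%:R : R) <> a%:R `^ ratr q) ->
  block_complexity (a%:R : R) b L.+1 = (b - a ^ L + L * (b - b %/ a))%N.
Proof.
move=> a1 b1 aLb irr; have b0 : (0 < b)%N by rewrite ltnW.
have aLb' : (a ^ L <= b)%N by exact: dvdn_leq.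
pose s := [seq prefix_block a b L N | N <- block_starts a b L].
have us : uniq s.
  rewrite map_inj_in_uniq ?block_starts_uniq //; exact: prefix_block_inj.
have fs : fset_set (digit_blocks (a%:R : R) b L.+1) = [fset t in s]%fset.
  apply/fsetP => t; rewrite in_fset_set ?inE; last exact: finite_digit_blocks.
  rewrite digit_blocksE //; apply/idP/idP => [/set_mem[N NL <-]|/mapP[N Ns ->]].
    have [N' N's ->] := same_block_as_start a1 b0 aLb NL.
    exact: map_f.
  apply/mem_set; exists N; last by [].
  exact: block_starts_range Ns.
rewrite /block_complexity fs card_fseq undup_id // size_map size_cat size_iota.
by rewrite size_allpairs !size_iota.
Qed.

Theorem theorem2p3 (R : realType) (a b : nat)
    (hb : (5 <= b)%N) (ha : (2 <= a)%N) (hab : (a ^ 2 %| b)%N)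
    (hirr : forall q : rat, (b%:R : R) <> a%:R `^ ratr q) :
  let p (n : nat) : nat := block_complexity (a%:R : R) b n in
  (p 3%N)%:Z - (p 2%N)%:Z <> (p 2%N)%:Z - (p 1%N)%:Z
  /\ ~ (exists c d : R,
         forall n : nat, (1 <= n)%N -> (p n)%:R = c * n%:R + d).
Proof.
move=> p; have b1 : (1 < b)%N by apply: leq_trans hb.
have pE L : (L <= 2)%N -> p L.+1 = (b - a ^ L + L * (b - b %/ a))%N.
  move=> L2; apply: block_complexity_expn => //.
  by apply: dvdn_trans hab; rewrite dvdn_exp2l.
clearbody p.
have pZ L : (L <= 2)%N ->
    (p L.+1)%:Z = b%:Z - a%:Z ^+ L + L%:Z * (b%:Z - (b %/ a)%N%:Z).
  move=> L2; have aLb : (a ^ L <= b)%N.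
    apply: dvdn_leq; first by rewrite ltnW.
    by apply: dvdn_trans hab; rewrite dvdn_exp2l.
  by rewrite pE // PoszD -subzn // PoszM -subzn ?leq_div // -rmorphXn.
have second_difference :
    (p 3)%:Z - (p 2)%:Z = (p 2)%:Z - (p 1)%:Z - (a%:Z - 1) ^+ 2.
  by rewrite !pZ //; ring.
have a1 : 0 < (a%:Z - 1) ^+ 2 by rewrite exprn_gt0 // subr_gt0 ltz_nat.
have neq : (p 3)%:Z - (p 2)%:Z <> (p 2)%:Z - (p 1)%:Z.
  by rewrite second_difference; lra.
split=> // -[c [d affine]]; apply: neq.
apply/eqP; rewrite -(eqr_int R) !rmorphB /= -!pmulrn !affine //.
by apply/eqP; ring.
Qed.
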